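(* Let $S$ be a Dedekind semidomain. Then for every maximal ideal $\mathfrak{m}$ of $S$ there is no ideal $\mathfrak{a}$ of $S$ strictly between $\mathfrak{m}^2$ and $\mathfrak{m}$, i.e. no ideal $\mathfrak{a}$ with $\mathfrak{m}^2\subsetneq\mathfrak{a}\subsetneq\mathfrak{m}$.
   Context: A semiring is $(S,+,\cdot,0,1)$ where $(S,+,0)$ and $(S,\cdot,1)$ are commutative monoids, $1\neq 0$, multiplication distributes over addition, and $a\cdot 0=0$ for all $a$. A semidomain is a semiring $S$ in which $ab=ac$ with $a\neq 0$ implies $b=c$. Its semifield of fractions $K=F(S)$ is the localization of $S$ at $S-\{0\}$. An ideal of $S$ is a nonempty subset closed under addition and under multiplication by elements of $S$. A fractional ideal of $S$ is a nonempty subset $A\subseteq K$ closed under addition and under multiplication by elements of $S$ such that $dA\subseteq S$ for some nonzero $d\in S$. The product of ideals or fractional ideals $A,B$ is $AB=\{\sum_{i=1}^n a_ib_i: a_i\in A, b_i\in B\}$, and $A$ is invertible if $AB=S$ for some fractional ideal $B$. A Dedekind semidomain is a semidomain in which each nonzero fractional ideal is invertible. *)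

(* Defs.v *)
From HB Require Import structures.
From mathcomp Require Import all_boot all_algebra generic_quotient.
From mathcomp Require Import classical_sets ring.

Set Implicit Arguments.
Unset Strict Implicit.
Unset Printing Implicit Defensive.

Import GRing.Theory.
Local Open Scope ring_scope.
Local Open Scope quotient_scope.
Local Open Scope classical_set_scope.

HB.mixin Record ComNzSemiRing_isSemidomain S of GRing.ComNzSemiRing S := {
  sd_cancel : forall a b c : S, a != 0 -> a * b = a * c -> b = c
}.

#[short(type="semidomainType")]
HB.structure Definition Semidomain :=
  {S of ComNzSemiRing_isSemidomain S & GRing.ComNzSemiRing S}.

Lemma sd_mulfI (S : semidomainType) (a : S) : a != 0 -> injective ( *%R a).
Proof. by move=> a0 b c; apply: sd_cancel. Qed.

Lemma sd_mulf_neq0 (S : semidomainType) (a b : S) :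
  a != 0 -> b != 0 -> a * b != 0.
Proof.
move=> a0; apply: contra_neq => ab0.
by apply: (sd_mulfI a0); rewrite ab0 mulr0.
Qed.

(* [fraction.v] covers only integral domains (rings), so the localization of
   [S] at its nonzero elements is built here, along the same lines.  Thanks to
   cancellation, (a, b) ~ (c, d) iff a * d = b * c. *)

Record sdratio (S : semidomainType) :=
  SdRatio { sdfrac :> S * S; _ : sdfrac.2 != 0 }.

HB.instance Definition _ (S : semidomainType) := [isSub for @sdfrac S].
HB.instance Definition _ (S : semidomainType) := [Choice of sdratio S by <:].

Section FractionSemifield.
Variable S : semidomainType.
Implicit Types x y z : sdratio S.

Lemma sdden_neq0 x : x.2 != 0. Proof. by case: x. Qed.

Definition sdequiv x y := x.1 * y.2 == x.2 * y.1.

Lemma sdequiv_refl : reflexive sdequiv.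
Proof. by move=> x; rewrite /sdequiv mulrC. Qed.

Lemma sdequiv_sym : symmetric sdequiv.
Proof. by move=> x y; rewrite /sdequiv eq_sym mulrC [y.2 * _]mulrC. Qed.

Lemma sdequiv_trans : transitive sdequiv.
Proof.
move=> y x z; rewrite /sdequiv => /eqP xy /eqP yz; apply/eqP.
apply: (sd_mulfI (sdden_neq0 y)).
by rewrite mulrA [y.2 * _]mulrC xy -mulrA yz mulrCA.
Qed.

Canonical sdequiv_equiv :=
  EquivRel sdequiv sdequiv_refl sdequiv_sym sdequiv_trans.

Definition sdfractions := {eq_quot sdequiv}.

HB.instance Definition _ : EqQuotient _ sdequiv sdfractions :=
  EqQuotient.on sdfractions.
HB.instance Definition _ := Choice.on sdfractions.

Definition sdof (a : S) : sdratio S := @SdRatio S (a, 1) (oner_neq0 S).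

Definition sdaddr x y : sdratio S :=
  @SdRatio S (x.1 * y.2 + y.1 * x.2, x.2 * y.2)
    (sd_mulf_neq0 (sdden_neq0 x) (sdden_neq0 y)).

Definition sdmulr x y : sdratio S :=
  @SdRatio S (x.1 * y.1, x.2 * y.2)
    (sd_mulf_neq0 (sdden_neq0 x) (sdden_neq0 y)).

Definition tosdfrac := lift_embed sdfractions sdof.
Canonical tosdfrac_pi_morph := PiEmbed tosdfrac.

Lemma sdequiv_repr x :
  (repr (\pi_sdfractions x)).1 * x.2 = (repr (\pi_sdfractions x)).2 * x.1.
Proof.
by apply/eqP; apply/(eqmodP sdequiv_equiv); rewrite reprK.
Qed.

Definition sdadd := lift_op2 sdfractions sdaddr.

Lemma pi_sdadd : {morph \pi : x y / sdaddr x y >-> sdadd x y}.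
Proof.
move=> x y; unlock sdadd; apply/eqmodP; rewrite /= /sdequiv /=.
move: (sdequiv_repr x) (sdequiv_repr y).
move: (repr _) (repr _) => y' x' ex ey; apply/eqP.
transitivity (x'.2 * x.1 * (y.2 * y'.2) + y'.2 * y.1 * (x.2 * x'.2)).
  by ring.
by rewrite -ex -ey; ring.
Qed.
Canonical pi_sdadd_morph := PiMorph2 pi_sdadd.

Definition sdmul := lift_op2 sdfractions sdmulr.

Lemma pi_sdmul : {morph \pi : x y / sdmulr x y >-> sdmul x y}.
Proof.
move=> x y; unlock sdmul; apply/eqmodP; rewrite /= /sdequiv /=; apply/eqP.
move: (sdequiv_repr x) (sdequiv_repr y).
move: (repr _) (repr _) => y' x' ex ey.
by rewrite [LHS]mulrC mulrACA -ex -ey; ring.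
Qed.
Canonical pi_sdmul_morph := PiMorph2 pi_sdmul.

Lemma sdaddA : associative sdadd.
Proof.
elim/quotW=> x; elim/quotW=> y; elim/quotW=> z; rewrite !piE.
congr (\pi_sdfractions _); apply: val_inj => /=; rewrite !mulrDl !mulrA !addrA.
by rewrite ![_ * _ * x.2]mulrAC.
Qed.

Lemma sdaddC : commutative sdadd.
Proof.
elim/quotW=> x; elim/quotW=> y; rewrite !piE.
by congr (\pi_sdfractions _); apply: val_inj; rewrite /= addrC [x.2 * _]mulrC.
Qed.

Lemma sdadd0 : left_id (tosdfrac 0) sdadd.
Proof.
elim/quotW=> x; rewrite !piE; congr (\pi_sdfractions _); apply: val_inj => /=.
by rewrite mul0r mulr1 mul1r add0r; case: x => [[]].
Qed.

HB.instance Definition _ :=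
  GRing.isNmodule.Build sdfractions sdaddA sdaddC sdadd0.

Lemma sdmulA : associative sdmul.
Proof.
elim/quotW=> x; elim/quotW=> y; elim/quotW=> z; rewrite !piE.
by congr (\pi_sdfractions _); apply: val_inj; rewrite /= !mulrA.
Qed.

Lemma sdmulC : commutative sdmul.
Proof.
elim/quotW=> x; elim/quotW=> y; rewrite !piE.
by congr (\pi_sdfractions _); apply: val_inj; rewrite /= mulrC [x.2 * _]mulrC.
Qed.

Lemma sdmul1 : left_id (tosdfrac 1) sdmul.
Proof.
elim/quotW=> x; rewrite !piE; congr (\pi_sdfractions _); apply: val_inj => /=.
by rewrite !mul1r; case: x => [[]].
Qed.

Lemma sdmulDl : left_distributive sdmul sdadd.
Proof.
elim/quotW=> x; elim/quotW=> y; elim/quotW=> z; apply/eqP.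
rewrite !piE /= /sdequiv /=; apply/eqP.
by ring.
Qed.

Lemma sdmul0 : left_zero (tosdfrac 0) sdmul.
Proof.
elim/quotW=> x; apply/eqP; rewrite !piE /= /sdequiv /=.
by rewrite !mul0r mulr0.
Qed.

Lemma sdone_neq0 : tosdfrac 1 != tosdfrac 0.
Proof. by rewrite piE /= /sdequiv /= mulr1 mulr0 oner_neq0. Qed.

HB.instance Definition _ :=
  GRing.Nmodule_isComNzSemiRing.Build sdfractions
    sdmulA sdmulC sdmul1 sdmulDl sdmul0 sdone_neq0.

Lemma tosdfracD (a b : S) : tosdfrac (a + b) = tosdfrac a + tosdfrac b.
Proof.
rewrite [RHS]/GRing.add /= !piE; congr (\pi_sdfractions _).
by apply: val_inj; rewrite /= !mulr1.
Qed.

Lemma tosdfracM (a b : S) : tosdfrac (a * b) = tosdfrac a * tosdfrac b.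
Proof.
rewrite [RHS]/GRing.mul /= !piE; congr (\pi_sdfractions _).
by apply: val_inj; rewrite /= !mulr1.
Qed.

Lemma tosdfrac0 : tosdfrac 0 = 0. Proof. by []. Qed.
Lemma tosdfrac1 : tosdfrac 1 = 1. Proof. by []. Qed.

Lemma tosdfrac_inj : injective tosdfrac.
Proof.
by move=> a b /eqP; rewrite piE /= /sdequiv /= mulr1 mul1r => /eqP.
Qed.

Lemma sdfractionsP (u : sdfractions) :
  exists a b : S, b != 0 /\ u * tosdfrac b = tosdfrac a.
Proof.
elim/quotW: u => x; exists x.1, x.2; split; first exact: sdden_neq0.
by apply/eqP; rewrite /GRing.mul /= piE /= /sdequiv /=; apply/eqP; ring.
Qed.

Lemma sdfractions_inv (u : sdfractions) : u != 0 -> exists v, u * v = 1.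
Proof.
elim/quotW: u => x; rewrite piE /= /sdequiv /= mulr1 mulr0 => x0.
exists (\pi_sdfractions (@SdRatio S (x.2, x.1) x0)); apply/eqP.
by rewrite /GRing.mul /= piE /= /sdequiv /=; apply/eqP; ring.
Qed.

End FractionSemifield.

(* Used with [R := S] for ideals and [R := sdfractions S] for fractional
   ideals; every sum has at least one term. *)
Definition idealM (R : comNzSemiRingType) (A B : set R) : set R :=
  [set x | exists (n : nat) (a b : 'I_n.+1 -> R),
     [/\ forall i, A (a i), forall i, B (b i) & x = \sum_i a i * b i]].

Definition is_ideal (S : comNzSemiRingType) (A : set S) : Prop :=
  [/\ A !=set0, forall x y, A x -> A y -> A (x + y)
    & forall s x, A x -> A (s * x)].

Definition is_maximal_ideal (S : comNzSemiRingType) (M : set S) : Prop :=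
  [/\ is_ideal M, M <> setT
    & forall J : set S, is_ideal J -> M `<=` J -> J = M \/ J = setT].

Definition fractional_ideal (S : semidomainType) (A : set (sdfractions S)) :
    Prop :=
  [/\ A !=set0, forall x y, A x -> A y -> A (x + y),
      forall (s : S) x, A x -> A (tosdfrac s * x)
    & exists2 d : S, d != 0 &
        forall x, A x -> range (@tosdfrac S) (tosdfrac d * x)].

Definition invertible_ideal (S : semidomainType) (A : set (sdfractions S)) :
    Prop :=
  exists2 B : set (sdfractions S),
    fractional_ideal B & idealM A B = range (@tosdfrac S).

Definition dedekind_semidomain (S : semidomainType) : Prop :=
  forall A : set (sdfractions S),
    fractional_ideal A -> A <> [set 0] -> invertible_ideal A.

(* Main.v *)
Require Import Defs.
From mathcomp Require Import all_boot all_algebra classical_sets.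

(* The colon ideal [(a : m)] contains [m] when [m^2] is contained in [a], so it
   is [m] or the whole of [S].  In the second case [m] is contained in [a].  In
   the first, write [1 = \sum_i m_i b_i] with [b_i] in the inverse of [m]: every
   [x] in [a] is [\sum_i m_i (b_i x)], where each [b_i x] lies in
   [(a : m) = m], so [a] is contained in [m^2]. *)

Local Open Scope classical_set_scope.
Import GRing.Theory.
Local Open Scope ring_scope.

Lemma ideal0 {S : comNzSemiRingType} {A : set S} : is_ideal A -> A 0.
Proof. by case=> -[x Ax] _ AM; rewrite -(mul0r x); apply: AM. Qed.

Lemma idealM_mul {R : comNzSemiRingType} {A B : set R} {x y : R} :
  A x -> B y -> idealM A B (x * y).
Proof.
(* The sums are indexed by ['I_n.+1], so [n = 0] gives a single term. *)
by move=> Ax By; exists 0, (fun=> x), (fun=> y); rewrite big_ord1.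
Qed.

Definition ideal_colon {S : comNzSemiRingType} (A B : set S) : set S :=
  [set s | forall y, B y -> A (s * y)].

Lemma ideal_colon_is_ideal {S : comNzSemiRingType} (A B : set S) :
  is_ideal A -> is_ideal (ideal_colon A B).
Proof.
move=> idA; have [_ AD AM] := idA; split.
- by exists 0 => y _; rewrite mul0r; apply: ideal0.
- by move=> s t As At y By; rewrite mulrDl; apply: AD; [apply: As|apply: At].
- by move=> s t At y By; rewrite -mulrA; apply: AM; apply: At.
Qed.

Lemma tosdfrac_sum {S : semidomainType} {n : nat} (f : 'I_n -> S) :
  tosdfrac (\sum_i f i) = \sum_i tosdfrac (f i).
Proof. exact: (big_morph _ (@tosdfracD S) (tosdfrac0 S)). Qed.

Lemma ideal_fractional {S : semidomainType} {A : set S} :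
  is_ideal A -> fractional_ideal (@tosdfrac S @` A).
Proof.
move=> [[x Ax] AD AM]; split.
- by exists (tosdfrac x), x.
- move=> _ _ [u Au <-] [v Av <-].
  by exists (u + v); [exact: AD | rewrite tosdfracD].
- by move=> s _ [u Au <-]; exists (s * u); [exact: AM | rewrite tosdfracM].
- exists 1; first exact: oner_neq0.
  by move=> _ [u _ <-]; exists u => //; rewrite tosdfrac1 mul1r.
Qed.

Lemma sub_idealM_colon {S : semidomainType} {A M : set S} :
  is_ideal A -> A `<=` M -> invertible_ideal (@tosdfrac S @` M) ->
  A `<=` idealM M (ideal_colon A M).
Proof.
move=> [_ _ AM] AsubM [B _ MB] x Ax.
(* Since [M B] is the image of [S], each single product lies in that image. *)
have integral y b : M y -> B b -> exists s, tosdfrac s = tosdfrac y * b.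
  move=> My Bb; have : range (@tosdfrac S) (tosdfrac y * b).
    by rewrite -MB; apply: idealM_mul => //; exists y.
  by case=> s _ <-; exists s.
have : idealM (@tosdfrac S @` M) B 1 by rewrite MB; exists 1.
move=> [n [c [b [Mc Bb E]]]].
have /fin_all_exists [y Hy] i : exists y, M y /\ tosdfrac y = c i.
  by have [y My <-] := Mc i; exists y.
(* Here [A] inside [M] is used: [x] is in [M], so [x b_i] lies in [S]. *)
have /fin_all_exists [s Hs] i : exists s, tosdfrac s = tosdfrac x * b i.
  by apply: integral => //; apply: AsubM.
exists n, y, s; split=> [i|i z Mz|]; first by case: (Hy i).
(* Regroup [(x b_i) z] as [(z b_i) x]: the factor [t = z b_i] lies in [S], so the product is a
   multiple of [x] and stays in [A]. *)
- have [t Ht] := integral z (b i) Mz (Bb i).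
  suff -> : s i * z = t * x by apply: AM.
  by apply: tosdfrac_inj; rewrite !tosdfracM Hs Ht mulrAC -mulrA mulrC.
- apply: tosdfrac_inj; rewrite tosdfrac_sum -[LHS]mulr1 E mulr_sumr.
  by apply: eq_bigr => i _; rewrite tosdfracM Hs (proj2 (Hy i)) mulrCA.
Qed.

Local Close Scope ring_scope.

Theorem corollary3p18 (S : semidomainType) (hS : dedekind_semidomain S)
    (m : set S) (hm : is_maximal_ideal m) :
  ~ exists a : set S, [/\ is_ideal a, idealM m m `<` a & a `<` m].
Proof.
case: hm => idm _ maxm [a [ida [m2a na_m2] [am nma]]].
(* A zero [m] would be contained in [a], against strictness; this makes the Dedekind hypothesis
   applicable to [m]. *)
have m_neq0 : @tosdfrac S @` m <> [set 0%R].
  move=> m0; apply: nma => y my.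
  have : (@tosdfrac S @` m) (tosdfrac y) by exists y.
  by rewrite m0 -tosdfrac0 => /tosdfrac_inj ->; apply: ideal0.
have m_colon : m `<=` ideal_colon a m.
  by move=> x mx y my; apply/m2a/idealM_mul.
have [colonE|colonE] := maxm _ (ideal_colon_is_ideal a m ida) m_colon.
(* Only the second factor of [idealM m m] is turned back into the colon ideal. *)
- apply: na_m2; rewrite -{2}colonE; apply: sub_idealM_colon => //.
  by apply: hS => //; apply: ideal_fractional.
(* That [1] lies in the colon ideal says exactly that [m] is contained in [a]. *)
- apply: nma => x mx; have : ideal_colon a m 1%R by rewrite colonE.
  by move=> /(_ x mx); rewrite mul1r.
Qed.
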